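(* Let $C_4$ be the $4$-cycle. There are constants $c,C>0$ such that for all sufficiently large $n$, $$c\,n^{3/2}<b_{C_4}(n)<n^{C\sqrt{\log n}}.$$
   Context: For a graph $G$, $\mathrm{cl}(G)$ denotes its clique complex. For a finite simple graph $H$ and a fixed field $\mathbb{K}$, $b_H(n)=\max_G \sum_{i\ge -1}\dim_{\mathbb{K}}\widetilde H_i(\mathrm{cl}(G);\mathbb{K})$, where $G$ ranges over all simple graphs on at most $n$ vertices containing no induced copy of $H$ (reduced homology, the empty graph contributing $1$). *)

(* Defs.v *)
From mathcomp Require Import all_boot all_order all_algebra.
Set Implicit Arguments. Unset Strict Implicit. Unset Printing Implicit Defensive.
Import GRing.Theory.
Local Open Scope ring_scope.

Definition adj m (E : {set 'I_m * 'I_m}) (x y : 'I_m) : bool := (x, y) \in E.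

Definition simple_graph m (E : {set 'I_m * 'I_m}) : bool :=
  [forall x, ~~ adj E x x] && [forall x, forall y, adj E x y == adj E y x].

Definition C4_adj (i j : 'I_4) : bool :=
  (nat_of_ord j == (i.+1 %% 4)%N) || (nat_of_ord i == (j.+1 %% 4)%N).

Definition has_induced_C4 m (E : {set 'I_m * 'I_m}) : bool :=
  [exists f : {ffun 'I_4 -> 'I_m},
     injectiveb f && [forall i, forall j, adj E (f i) (f j) == C4_adj i j]].

(* cliques of G (faces of the clique complex cl(G)), including the empty face *)
Definition clique m (E : {set 'I_m * 'I_m}) (A : {set 'I_m}) : bool :=
  [forall x in A, forall y in A, (x != y) ==> adj E x y].

Section Homology.
Variable K : fieldType.
Variable m : nat.

(* chains: K-valued functions on subsets of the vertex set; a face with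
   s vertices (dimension s-1) is oriented by the natural order of 'I_m *)
Definition chains := {ffun {set 'I_m} -> K^o}.

Definition chain_of (A : {set 'I_m}) : chains := [ffun B => if B == A then 1 else 0].

Definition incidence (sigma tau : {set 'I_m}) : K :=
  if (tau \subset sigma) && (#|sigma| == #|tau|.+1) then
    \sum_(v in sigma :\: tau) (-1) ^+ #|[set u in sigma | (u < v)%N]|
  else 0.

Definition boundary_fun (f : chains) : chains :=
  [ffun tau => \sum_(sigma : {set 'I_m}) f sigma * incidence sigma tau].

Definition boundary : 'End(chains) := linfun boundary_fun.

(* C_{s-1}(cl G): span of the faces with s vertices *)
Definition chain_space (E : {set 'I_m * 'I_m}) (s : nat) : {vspace chains} :=
  <<[seq chain_of A | A <- enum [set A : {set 'I_m} | clique E A && (#|A| == s)]]>>%VS.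

(* dim of reduced homology in degree s-1:  dim ker d_{s-1} - dim im d_s *)
Definition reduced_betti (E : {set 'I_m * 'I_m}) (s : nat) : nat :=
  (\dim (lker boundary :&: chain_space E s) - \dim (boundary @: chain_space E s.+1))%N.

(* sum over i >= -1 of dim H~_i(cl G; K); faces have at most m vertices *)
Definition total_betti (E : {set 'I_m * 'I_m}) : nat :=
  (\sum_(s < m.+1) reduced_betti E s)%N.
End Homology.

Definition b_C4 (K : fieldType) (n : nat) : nat :=
  (\max_(m < n.+1)
     \max_(E : {set 'I_m * 'I_m} | simple_graph E && ~~ has_induced_C4 E)
        total_betti K E)%N.

(* Main.v *)
(** Upper bound: if [G] is C4-free on [n] vertices, its clique complex has no
    homology on faces with more than [O(sqrt (log n))] vertices, so the total
    Betti number is at most the number of cliques of that size.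

    Deleting a vertex [x] can only lose homology that lives, one degree lower, in
    the link [N(x)].  For an edge [xy], [N(x)] is a cone with apex [y] plus the
    private neighbourhood [W = N(x) - N[y]], and the C4-free condition (common
    neighbours of nonadjacent vertices form a clique; neighbourhoods in a clique of
    adjacent vertices are nested) shows that its homology is controlled, up to two
    more degrees, by the subsets of [W].  The private neighbourhoods of [x] and [y]
    are anticomplete, so one of them has at most half of the independence number
    [alpha]: homology vanishes above degree [3 log alpha + O(1)].  For a threshold
    [t], vertices of degree below [n / t], and vertices [x] with an edge [xy] such
    that [|N(x) - N[y]| < n / t], may be deleted at the cost of passing to sets of
    size below [n / t]; once none is left, double counting gives [alpha < t^2].
    Taking [t = 2 ^ sqrt (log n)] balances the two contributions.

    Lower bound: the point-line incidence graph of the affine plane over the field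
    with [q = 2 ^ k] elements has girth at least 6, [2 q^2] vertices and [q^3] edges,
    hence first Betti number at least [q^3 - 2 q^2]. *)

Require Import Defs.
From HB Require Import structures.
From mathcomp Require Import all_boot all_algebra finfield zify ring.
Set Implicit Arguments. Unset Strict Implicit. Unset Printing Implicit Defensive.
Import GRing.Theory.

(** * Simplicial chains: join with a vertex, link and deletion *)

Section Chains.
Local Open Scope ring_scope.
Variables (K : fieldType) (m : nat).
Implicit Types (f u z w : chains K m) (A B : {set 'I_m}) (v x y : 'I_m).

(** The sign of inserting [v] into [A], or of removing it: only vertices below [v] count, so it does
    not matter whether [v] lies in [A]. *)
Definition vertex_sign v A : K := (-1) ^+ #|[set u in A | (u < v)%N]|.

Lemma vertex_signK v A : vertex_sign v A * vertex_sign v A = 1.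
Proof. by rewrite /vertex_sign -expr2 -exprM mulnC exprM sqrrN !expr1n. Qed.

Lemma vertex_signU v x A : x \notin A ->
  vertex_sign v (x |: A) = (-1) ^+ (x < v)%N * vertex_sign v A.
Proof.
move=> xA; rewrite /vertex_sign -exprD; congr (_ ^+ _).
have -> : [set u in x |: A | (u < v)%N] =
   [set u in [set x] | (u < v)%N] :|: [set u in A | (u < v)%N].
  by apply/setP => u; rewrite !inE andb_orl.
rewrite cardsU; set I := _ :&: _; have -> : I = set0.
  apply/setP => u; rewrite !inE; case: eqP => //= ->.
  by rewrite (negbTE xA) /= andbF.
rewrite cards0 subn0; congr addn.
case xv: (x < v)%N.
  rewrite (_ : [set u in _ | _] = [set x]) ?cards1 //.
  by apply/setP => u; rewrite !inE; case: eqP => //= ->.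
rewrite (_ : [set u in _ | _] = set0) ?cards0 //.
by apply/setP => u; rewrite !inE; case: eqP => //= ->.
Qed.

Lemma vertex_signUx x A : vertex_sign x (x |: A) = vertex_sign x A.
Proof.
have [xA|xA] := boolP (x \in A); first by rewrite (setUidPr _) ?sub1set.
by rewrite vertex_signU // ltnn mul1r.
Qed.

Lemma boundary_funE f A :
  boundary_fun f A = \sum_(v | v \notin A) vertex_sign v A * f (v |: A).
Proof.
rewrite ffunE; set S := [set v |: A | v in ~: A].
rewrite (bigID (mem S)) /= [X in _ + X]big1 ?addr0.
  rewrite big_imset /=; last first.
    move=> v w; rewrite !inE => vA wA /setP /(_ v); rewrite !inE eqxx /=.
    by rewrite (negbTE vA) orbF => /esym/eqP.
  apply: eq_big => [v|v]; first by rewrite inE.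
  rewrite inE => vA; rewrite /incidence subsetUr cardsU1 vA eqxx /=.
  rewrite (_ : (v |: A) :\: A = [set v]) ?big_set1; last first.
    by apply/setP => u; rewrite !inE; case: eqP => [->|_]; rewrite ?vA ?andbT ?orbF // andNb.
  by rewrite -/(vertex_sign v (v |: A)) vertex_signUx mulrC.
move=> B; rewrite /incidence; case: ifP => [/andP[AB /eqP cB] /negP[]|]; last by rewrite mulr0.
have /cards1P[v Ev] : #|B :\: A| == 1%N.
  by rewrite cardsD (setIidPr AB) cB subSnn.
have: v \in B :\: A by rewrite Ev set11.
rewrite inE => /andP[vA vB]; apply/imsetP; exists v; first by rewrite inE.
by rewrite -Ev setUC setDE setUIr setUCr setIT (setUidPr AB).
Qed.

Lemma boundary_fun_is_linear : linear (@boundary_fun K m).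
Proof.
move=> a f u; apply/ffunP => A; rewrite ffunE [RHS]ffunE [X in _ = X + _]ffunE !ffunE.
rewrite /GRing.scale /= mulr_sumr -big_split /=; apply: eq_bigr => B _.
by rewrite !ffunE mulrDl mulrA.
Qed.

HB.instance Definition _ :=
  GRing.isLinear.Build K (chains K m) (chains K m) _ (@boundary_fun K m) boundary_fun_is_linear.

Lemma boundaryE f : boundary K m f = boundary_fun f.
Proof. by rewrite lfunE. Qed.

(* [x * u] in the join notation; sets not containing [x] get coefficient [0]. *)
Definition cone_chain x u : chains K m :=
  [ffun A : {set 'I_m} => if x \in A then vertex_sign x A * u (A :\ x) else 0].

Lemma cone_chainN x u : cone_chain x (- u) = - cone_chain x u.
Proof. by apply/ffunP => A; rewrite !ffunE; case: ifP; rewrite ?oppr0 ?mulrN. Qed.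

Definition link_chain x z : chains K m :=
  [ffun A : {set 'I_m} => if x \in A then 0 else vertex_sign x A * z (x |: A)].

Definition deletion_chain x z : chains K m :=
  [ffun A : {set 'I_m} => if x \in A then 0 else z A].

Lemma chain_split x z : z = deletion_chain x z + cone_chain x (link_chain x z).
Proof.
apply/ffunP => A; rewrite !ffunE; case: ifP => xA; last by rewrite addr0.
rewrite add0r !inE eqxx /= setD1K // mulrA.
by rewrite -(vertex_signUx x (A :\ x)) setD1K // vertex_signK mul1r.
Qed.

(** Leibniz rule for the join with [x]. *)
Lemma boundary_cone x u : (forall A, x \in A -> u A = 0) ->
  boundary_fun (cone_chain x u) = u - cone_chain x (boundary_fun u).
Proof.
move=> u0; apply/ffunP => A.
have subE (g : chains K m) : (u - g) A = u A - g A by rewrite !ffunE.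
rewrite boundary_funE subE [cone_chain x (boundary_fun u) A]ffunE.
case: ifP => xA.
  rewrite u0 // add0r boundary_funE mulr_sumr -sumrN.
  rewrite [RHS](bigD1 x) /=; last by rewrite !inE eqxx.
  rewrite [u (x |: _)]u0 ?inE ?eqxx // !mulr0 oppr0 add0r.
  apply: eq_big => [v|v vA].
    by rewrite !inE negb_and negbK; case: eqP => [->|]; rewrite ?xA ?andbF ?andbT.
  have vx : v != x by apply: contraNneq vA => ->.
  rewrite ffunE !inE xA orbT.
  rewrite (_ : (v |: A) :\ x = v |: A :\ x); last first.
    by apply/setP => w; rewrite !inE; case: (w =P v) => [->|]; rewrite ?vx ?orbF.
  rewrite vertex_signU // -{1}(setD1K xA) [vertex_sign v _]vertex_signU ?inE ?eqxx //.
  rewrite !mulrA -mulNr; congr (_ * _).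
  (* Exactly one of [v < x] and [x < v] holds, so exchanging the two insertions costs one factor
     [-1]. *)
  have [h|h|/val_inj h] := ltngtP v x; last by rewrite h eqxx in vx.
    by rewrite !expr0 !expr1 mul1r mulrN1 mulNr mulrC.
  by rewrite expr0 expr1 mulr1 !mulN1r mulNr mulrC.
rewrite subr0 (bigD1 x) ?xA //= ffunE setU11 vertex_signUx setU1K ?xA // mulrA vertex_signK mul1r.
rewrite big1 ?addr0 // => v /andP[vA vx].
by rewrite ffunE !inE eq_sym (negbTE vx) xA mulr0.
Qed.

Section Cycle.
Variables (x : 'I_m) (z : chains K m).
Hypothesis zcyc : boundary_fun z = 0.

Lemma link_chain0 A : x \in A -> link_chain x z A = 0.
Proof. by move=> xA; rewrite ffunE xA. Qed.

(** The cycle condition on the decomposition [chain_split]: faces avoiding [x] yield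
    [boundary_deletion], faces through [x] yield [boundary_link]. *)
Lemma boundary_split A :
  boundary_fun (deletion_chain x z) A + link_chain x z A
    - cone_chain x (boundary_fun (link_chain x z)) A = 0.
Proof.
move: (congr1 (fun f : chains K m => f A) zcyc).
rewrite {1}(chain_split x z) raddfD /= boundary_cone ?[_ 0 A]ffunE; last exact: link_chain0.
by rewrite !ffunE addrA.
Qed.

Lemma boundary_deletion0 A : x \in A -> boundary_fun (deletion_chain x z) A = 0.
Proof.
move=> xA; rewrite boundary_funE big1 // => v _.
by rewrite ffunE !inE xA orbT mulr0.
Qed.

Lemma boundary_deletion : boundary_fun (deletion_chain x z) = - link_chain x z.
Proof.
apply/ffunP => A; rewrite [RHS]ffunE.
have [xA|xA] := boolP (x \in A); first by rewrite boundary_deletion0 // link_chain0 // oppr0.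
have := boundary_split A; rewrite [X in _ - X]ffunE (negbTE xA) subr0.
by move/eqP; rewrite addr_eq0 => /eqP.
Qed.

Lemma boundary_link : boundary_fun (link_chain x z) = 0.
Proof.
apply/ffunP => A; rewrite [RHS]ffunE.
have [xA|xA] := boolP (x \in A).
  rewrite boundary_funE big1 // => v _.
  by rewrite link_chain0 ?mulr0 // !inE xA orbT.
have := boundary_split (x |: A).
rewrite boundary_deletion0 ?setU11 // link_chain0 ?setU11 // addr0 add0r ffunE setU11 setU1K //.
move/eqP; rewrite oppr_eq0 mulf_eq0 => /orP[/eqP s0|/eqP //].
have := vertex_signK x (x |: A); rewrite s0 mul0r => /esym/eqP.
by rewrite oner_eq0.
Qed.
End Cycle.
End Chains.

(** * Vanishing of homology under vertex deletion *)

Section Vanishing.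
Local Open Scope ring_scope.
Variables (K : fieldType) (m : nat) (E : {set 'I_m * 'I_m}).
Hypothesis simpleE : simple_graph E.
Implicit Types (f u z w : chains K m) (A X Y : {set 'I_m}) (v x y : 'I_m).

Lemma adj_irr x : adj E x x = false.
Proof. by case/andP: simpleE => /forallP /(_ x) /negbTE. Qed.

Lemma adj_sym x y : adj E x y = adj E y x.
Proof. by case/andP: simpleE => _ /forallP /(_ x) /forallP /(_ y) /eqP. Qed.

Definition nbh x : {set 'I_m} := [set y | adj E x y].

Lemma cliqueP A :
  reflect {in A &, forall x y, x != y -> adj E x y} (clique E A).
Proof.
apply: (iffP forall_inP) => [cA x y xA yA xy|cA x xA].
  by move/forall_inP: (cA x xA) => /(_ y yA); rewrite xy.
by apply/forall_inP => y yA; apply/implyP; apply: cA.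
Qed.

Lemma cliqueS A X : A \subset X -> clique E X -> clique E A.
Proof.
by move=> /subsetP AX /cliqueP cX; apply/cliqueP => x y /AX xX /AX yX; apply: cX.
Qed.

Lemma cliqueU1 x A : A \subset nbh x -> clique E A -> clique E (x |: A).
Proof.
move=> /subsetP Ax /cliqueP cA; apply/cliqueP => u v; rewrite !inE.
case/predU1P => [->|uA]; case/predU1P => [->|vA]; first by rewrite eqxx.
- by move=> _; have := Ax _ vA; rewrite inE.
- by move=> _; have := Ax _ uA; rewrite inE adj_sym.
- exact: cA.
Qed.

(* A chain of [cl G[X]] on faces with [s] vertices, i.e. of dimension [s - 1]. *)
Definition chain_on X s f :=
  forall A, f A != 0 -> [/\ clique E A, #|A| = s & A \subset X].

(** Reduced homology of [cl G[X]] is zero in degree [s - 1]. *)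
Definition vanishing X s := forall z, chain_on X s z -> boundary_fun z = 0 ->
  exists2 u, chain_on X s.+1 u & boundary_fun u = z.

Lemma chain_onD X s f u : chain_on X s f -> chain_on X s u -> chain_on X s (f + u).
Proof.
move=> hf hu A; rewrite ffunE; have [->|/hf//] := eqVneq (f A) 0.
by rewrite add0r => /hu.
Qed.

Lemma chain_onN X s f : chain_on X s f -> chain_on X s (- f).
Proof. by move=> hf A; rewrite ffunE oppr_eq0 => /hf. Qed.

Lemma chain_onS X Y s f : X \subset Y -> chain_on X s f -> chain_on Y s f.
Proof. by move=> XY hf A /hf[? ? AX]; split=> //; apply: subset_trans XY. Qed.

Lemma chain_on_cone X s x f : x \in X -> chain_on (X :&: nbh x) s f ->
  chain_on X s.+1 (cone_chain x f).
Proof.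
move=> xX hf A; rewrite ffunE; case: ifP => xA; last by rewrite eqxx.
rewrite mulf_eq0 negb_or => /andP[_ /hf[cA sA]].
rewrite subsetI => /andP[AX Ax]; rewrite -(setD1K xA); split.
- exact: cliqueU1.
- by rewrite cardsU1 sA !inE eqxx.
- by rewrite subUset sub1set xX.
Qed.

Lemma chain_on_link X s x z :
  chain_on X s.+1 z -> chain_on (X :&: nbh x) s (link_chain x z).
Proof.
move=> hz A; rewrite ffunE; case: ifP => xA; first by rewrite eqxx.
rewrite mulf_eq0 negb_or => /andP[_ /hz[cA]]; rewrite cardsU1 xA => -[sA] AX.
split=> //; first by apply: cliqueS cA; apply: subsetUr.
rewrite subsetI (subset_trans _ AX) ?subsetUr //=.
apply/subsetP => y yA; rewrite inE; apply: (cliqueP _ cA); rewrite ?setU11 ?setU1r //.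
by apply: contraFneq xA => ->.
Qed.

Lemma chain_on_deletion X s x z :
  chain_on X s z -> chain_on (X :\ x) s (deletion_chain x z).
Proof.
move=> hz A; rewrite ffunE; case: ifP => xA; first by rewrite eqxx.
by move/hz=> [? ? ?]; split=> //; rewrite subsetD1 xA andbT.
Qed.

(** Mayer-Vietoris on chains: fill the link of [z] by [u]; the deletion plus [u] is then a cycle
    avoiding [x], filled by some [v], and [v] minus the join of [x] with [u] fills [z]. *)
Lemma vanishing_deletion X x s : x \in X ->
  vanishing (X :\ x) s.+1 -> vanishing (X :&: nbh x) s -> vanishing X s.+1.
Proof.
move=> xX hdel hlink z hz zcyc.
have [u hu uE] := hlink _ (chain_on_link hz) (boundary_link x zcyc).
have ux A : x \in A -> u A = 0.
  move=> xA; apply/eqP; case: eqVneq => // /hu[_ _ /subsetP/(_ x xA)].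
  by rewrite !inE adj_irr andbF.
have [||v hv vE] := hdel (deletion_chain x z + u).
- apply: chain_onD; first exact: chain_on_deletion.
  apply: chain_onS hu; apply/subsetP => y; rewrite !inE => /andP[->].
  by rewrite andbT; apply: contraTneq => ->; rewrite adj_irr.
- by rewrite raddfD /= uE boundary_deletion // addNr.
exists (v - cone_chain x u).
  apply: chain_onD; first by apply: chain_onS hv; apply: subsetDl.
  by apply: chain_onN; apply: chain_on_cone.
rewrite raddfB /= boundary_cone // vE uE {3}(chain_split x z).
by rewrite opprB addrACA subrr addr0.
Qed.

(** The join of [y] with the part of [z] avoiding [y] fills [z], because that part has boundary
    minus the link. *)
Lemma vanishing_cone X y s :
  y \in X -> {in X, forall x, x != y -> adj E y x} -> vanishing X s.
Proof.
move=> yX hy z hz zcyc; exists (cone_chain y (deletion_chain y z)).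
  apply: chain_on_cone => //; apply: chain_onS (chain_on_deletion (x := y) hz).
  by apply/subsetP => x; rewrite !inE => /andP[xy xX]; rewrite xX hy.
rewrite boundary_cone; last by move=> A yA; rewrite ffunE yA.
by rewrite boundary_deletion // cone_chainN opprK -chain_split.
Qed.
End Vanishing.

(** * Homology of clique complexes of C4-free graphs *)

Section C4free.
Variables (K : fieldType) (m : nat) (E : {set 'I_m * 'I_m}).
Hypothesis simpleE : simple_graph E.
Hypothesis C4E : ~~ has_induced_C4 E.
Implicit Types (A I Q W X Y : {set 'I_m}) (u v x y : 'I_m).

Let adjC := adj_sym simpleE.
Let adj0 := adj_irr simpleE.
Local Notation nbh := (nbh E).
Local Notation vanishing := (vanishing K E).

Lemma adj_neq x y : adj E x y -> x != y.
Proof. by apply: contraTneq => ->; rewrite adj0. Qed.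

Lemma C4_chord a b c d : adj E a b -> adj E b c -> adj E c d -> adj E d a ->
  a != c -> b != d -> adj E a c || adj E b d.
Proof.
move=> ab bc cd da ac bd; apply: contraR C4E; rewrite negb_or => /andP[nac nbd].
apply/existsP; exists [ffun i : 'I_4 => nth a [:: a; b; c; d] i].
have := (adj_neq ab, adj_neq bc, adj_neq cd, adj_neq da) => -[[[/eqP hab /eqP hbc] /eqP hcd] /eqP hda].
move/eqP: ac => ac; move/eqP: bd => bd.
apply/andP; split.
  apply/injectiveP => -[[|[|[|[|//]]]] hi] [[|[|[|[|//]]]] hj]; rewrite !ffunE /= => h; by [apply: val_inj|case: notF; congruence].
apply/forallP => -[[|[|[|[|//]]]] hi]; apply/forallP => -[[|[|[|[|//]]]] hj];
  rewrite !ffunE /C4_adj /= ?adj0 ?ab ?bc ?cd ?da ?(negbTE nac) ?(negbTE nbd) //;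
  by rewrite adjC ?ab ?bc ?cd ?da ?(negbTE nac) ?(negbTE nbd).
Qed.

(** Quantifying over all subsets makes the bound stable under deletions and under passing to
    links. *)
Definition vanishing_above k W :=
  forall Y s, Y \subset W -> k <= s -> vanishing Y s.

Lemma vanishing_aboveS k l W X :
  W \subset X -> k <= l -> vanishing_above k X -> vanishing_above l W.
Proof.
move=> WX kl hX Y s YW ls; apply: hX; [exact: subset_trans WX|exact: leq_trans ls].
Qed.

Lemma vanishing_delete k X x s : x \in X -> k < s ->
  vanishing (X :\ x) s -> vanishing_above k (X :&: nbh x) -> vanishing X s.
Proof.
by case: s => // s xX ks hdel hlink; apply: (vanishing_deletion simpleE xX hdel); apply: hlink.
Qed.

(* Neighbourhoods in [Q] of adjacent vertices are nested, so a vertex outside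
   [Q] with fewest neighbours in [Q] is dominated by each of them. *)
Lemma vanishing_dominating_clique Q X s : Q \subset X -> clique E Q -> Q != set0 ->
  {in X :\: Q, forall x, nbh x :&: Q != set0} -> vanishing X s.+1.
Proof.
move En: #|X :\: Q| => n; elim: n X En => [|n IH] X En QX cQ Q0 hX.
  have {hX En} XQ : X = Q.
    by apply/eqP; rewrite eqEsubset QX andbT -setD_eq0 -cards_eq0 En.
  have /set0Pn[q qQ] := Q0; apply: (@vanishing_cone _ _ _ simpleE _ q); rewrite XQ // => x xQ xq.
  by apply: (cliqueP _ _ cQ); rewrite // eq_sym.
have /set0Pn[x0 x0X] : X :\: Q != set0 by rewrite -cards_eq0 En.
case: (arg_minnP (fun x => #|nbh x :&: Q|) x0X) => v vXQ' vmin.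
have {vXQ'} vXQ : v \in X :\: Q by exact: vXQ'.
have /setDP[vX vQ] := vXQ.
have /set0Pn[q] := hX v vXQ; rewrite !inE => /andP[vq qQ].
apply: (vanishing_deletion simpleE vX).
  apply: IH => //.
  - have := cardsD1 v (X :\: Q); rewrite vXQ En add1n => -[->].
    by apply: eq_card => u; rewrite !inE andbCA.
  - by rewrite subsetD1 QX.
  - by move=> x; rewrite !inE => /and3P[xQ _ xX]; apply: hX; rewrite inE xQ.
(* The link of [v] is a cone with apex [q]: a neighbour [x] of [v] missing [q] either has strictly
   fewer neighbours in [Q] than [v], or gives a chordless cycle [v q q' x]. *)
apply: (@vanishing_cone _ _ _ simpleE _ q).
  by rewrite !inE vq (subsetP QX).
move=> x; rewrite !inE => /andP[xX vx] xq.
have [xQ|xQ] := boolP (x \in Q); first by apply: (cliqueP _ _ cQ); rewrite // eq_sym.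
apply: contraT => nqx.
have [xv|/subsetPn[q']] := boolP (nbh x :&: Q \subset nbh v :&: Q).
  have : nbh x :&: Q \proper nbh v :&: Q.
    rewrite properE xv; apply/subsetPn; exists q; rewrite !inE ?vq ?qQ //.
    by rewrite adjC (negbTE nqx).
  have xXQ : x \in X :\: Q by rewrite inE xQ.
  by move/proper_card; rewrite ltnNge vmin.
rewrite !inE => /andP[xq' q'Q]; rewrite q'Q andbT => nvq'.
have qq' : q != q' by apply: contraNneq nvq' => <-.
have := @C4_chord v q q' x vq; rewrite (negbTE nvq') (negbTE nqx) /=.
apply; rewrite 1?adjC //.
- by rewrite adjC (cliqueP _ _ cQ).
- by apply: contraNneq vQ => ->.
- by rewrite eq_sym.
Qed.

(** A vertex of [W] outside [Q] with no neighbour in [Q] has its link inside [W] and can be deleted.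
    Once there are none, [Q] is empty or dominating. *)
Lemma vanishing_cliqueU k Q W s : clique E Q -> vanishing_above k W -> k < s ->
  vanishing (Q :|: W) s.
Proof.
move=> cQ; move En: #|W| => n; elim: n W En => [|n IH] W En hW ks.
  have /eqP-> : W == set0 by rewrite -cards_eq0 En.
  rewrite setU0; have [->|Q0] := eqVneq Q set0; first by apply: hW; [exact: sub0set|exact: ltnW].
  case: s ks => // s _; apply: (@vanishing_dominating_clique Q) => // x.
  by rewrite setDv inE.
have [Q0|Q0] := eqVneq Q set0; first by rewrite Q0 set0U; apply: hW; [|exact: ltnW].
have [/existsP[w /and3P[wW wQ /eqP wQ0]]|] :=
  boolP [exists w, [&& w \in W, w \notin Q & nbh w :&: Q == set0]].
  apply: (@vanishing_delete k _ w) => //; first by rewrite inE wW orbT.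
    rewrite setDUl (_ : Q :\ w = Q); last by apply/setDidPl; rewrite disjoint_sym disjoints1.
    apply: IH => //; last by apply: vanishing_aboveS hW => //; apply: subsetDl.
    by have := cardsD1 w W; rewrite wW En => -[].
  apply: vanishing_aboveS hW => //.
  by rewrite setIUl [Q :&: _]setIC wQ0 set0U subsetIl.
move/existsPn => hn.
case: s ks {IH} => // s _; apply: (@vanishing_dominating_clique Q) => //; first exact: subsetUl.
move=> x; rewrite !inE => /andP[xQ]; rewrite (negbTE xQ) /= => xW.
by have := hn x; rewrite xW xQ.
Qed.

(** Delete the vertices [w] outside the closed neighbourhood of [y] one by one; what remains is a
    cone with apex [y]. The link of [w] is a clique, its common neighbours with [y], plus vertices
    not adjacent to [y]. *)
Lemma vanishing_star k X y s : y \in X -> vanishing_above k (X :\: (y |: nbh y)) ->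
  k.+1 < s -> vanishing X s.
Proof.
move En: #|X| => n; elim: n X En => [|n IH] X En yX hW ks.
  by move/eqP: En; rewrite cards_eq0 => /eqP X0; rewrite X0 inE in yX.
have [X0|/set0Pn[w]] := eqVneq (X :\: (y |: nbh y)) set0.
  apply: (@vanishing_cone _ _ _ simpleE _ y) => // x xX xy.
  by move/setP: X0 => /(_ x); rewrite !inE xX andbT (negbTE xy) /= => /negbFE.
rewrite !inE negb_or => /andP[/andP[wy nyw] wX].
apply: (@vanishing_delete k.+1 _ w) => //.
  apply: IH => //.
  - by have := cardsD1 w X; rewrite wX En => -[].
  - by rewrite !inE eq_sym wy.
  - by apply: vanishing_aboveS hW => //; apply: setSD; apply: subsetDl.
move=> Y s' YX ks'.
have -> : Y = (Y :&: nbh y) :|: (Y :\: nbh y) by rewrite setID.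
apply: (@vanishing_cliqueU k) => //.
  (* Nonadjacent common neighbours [u], [v] of [w] and [y] would give the induced cycle
     [w u y v]. *)
  apply/cliqueP => u v; rewrite !inE => /andP[/(subsetP YX) uY yu] /andP[/(subsetP YX) vY yv] uv.
  move: uY vY; rewrite !inE => /andP[_ wu] /andP[_ wv].
  have := @C4_chord w u y v wu; rewrite [adj E w y]adjC (negbTE nyw) /=.
  by apply => //; rewrite adjC.
apply: vanishing_aboveS hW => //.
apply/subsetP => u; rewrite !inE => /andP[nyu /(subsetP YX)]; rewrite !inE => /andP[-> wu].
rewrite (negbTE nyu) orbF andbT; apply: contraNneq nyw => uy.
by rewrite -uy adjC.
Qed.

(** Apply [vanishing_star] to [y] inside the link of [x]; passing to the link costs one more
    degree. *)
Lemma vanishing_edge k X x y s : x \in X -> y \in X -> adj E x y ->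
  vanishing_above k (X :&: nbh x :\: (y |: nbh y)) -> k.+2 < s ->
  vanishing (X :\ x) s -> vanishing X s.
Proof.
move=> xX yX xy hW; case: s => // s ks hdel.
apply: (vanishing_deletion simpleE xX hdel).
by apply: (@vanishing_star k _ y) => //; rewrite !inE yX.
Qed.

(** The threshold is 1 because the empty face is a nonbounding cycle at [s = 0]. *)
Lemma vanishing_above0 : vanishing_above 1 set0.
Proof.
move=> Y s; rewrite subset0 => /eqP -> s1 z hz _; exists 0%R.
  by move=> A; rewrite ffunE eqxx.
rewrite GRing.raddf0; apply/ffunP => A; rewrite ffunE; apply/esym/eqP.
case: eqVneq => // /hz[_ sA]; rewrite subset0 => /eqP A0.
by move: s1; rewrite -sA A0 cards0.
Qed.

(** * Independence number and degree thresholds *)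

Definition independent I := [forall x in I, forall y in I, ~~ adj E x y].

Lemma independentP I :
  reflect {in I &, forall x y, ~~ adj E x y} (independent I).
Proof.
apply: (iffP forall_inP) => [hI x y xI yI|hI x xI].
  by move/forall_inP: (hI x xI); apply.
by apply/forall_inP => y yI; apply: hI.
Qed.

Definition alpha X := \max_(I : {set 'I_m} | independent I && (I \subset X)) #|I|.

Lemma alpha_witness X : exists I, [/\ independent I, I \subset X & #|I| = alpha X].
Proof.
have h0 : independent set0 && (set0 \subset X).
  by rewrite sub0set andbT; apply/independentP => x y; rewrite inE.
rewrite /alpha (bigmax_eq_arg set0) //; case: arg_maxnP => // I /andP[? ?] _.
by exists I.
Qed.

Lemma leq_alpha X I : independent I -> I \subset X -> #|I| <= alpha X.
Proof. by move=> hI IX; apply: leq_bigmax_cond; rewrite hI. Qed.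

Lemma alphaS X Y : X \subset Y -> alpha X <= alpha Y.
Proof.
move=> XY; have [I [hI IX <-]] := alpha_witness X.
by apply: leq_alpha => //; apply: subset_trans XY.
Qed.

Lemma alpha_anticomplete X W W' : W \subset X -> W' \subset X ->
  [disjoint W & W'] -> {in W & W', forall u v, ~~ adj E u v} ->
  alpha W + alpha W' <= alpha X.
Proof.
move=> WX WX' dW hW; have [I [hI IW <-]] := alpha_witness W.
have [J [hJ JW <-]] := alpha_witness W'.
have dIJ : [disjoint I & J] by apply: disjointWl IW _; apply: disjointWr JW _.
rewrite -cardsUI (eqP (_ : I :&: J == set0)) ?setI_eq0 // cards0 addn0.
apply: leq_alpha; last by rewrite subUset (subset_trans IW) ?(subset_trans JW).
apply/independentP => u v; rewrite !inE => /orP[uI|uJ] /orP[vI|vJ].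
- exact: (independentP _ hI).
- by apply: hW; [apply: (subsetP IW)|apply: (subsetP JW)].
- by rewrite adjC; apply: hW; [apply: (subsetP IW)|apply: (subsetP JW)].
- exact: (independentP _ hJ).
Qed.

(* For an edge [xy], the private neighbourhoods of [x] and [y] are anticomplete,
   so one of them has at most half of the independence number. *)
Lemma vanishing_alpha a X : alpha X < 2 ^ a -> vanishing_above (3 * a).+1 X.
Proof.
elim: a X => [|a IHa] X aX.
  suff -> : X = set0 by exact: vanishing_above0.
  apply/eqP; apply: contraTT aX => /set0Pn[x xX]; rewrite -leqNgt expn0.
  rewrite -(cards1 x); apply: leq_alpha; last by rewrite sub1set.
  by apply/independentP => u v; rewrite !inE => /eqP-> /eqP->; rewrite adj0.
move=> Y s /alphaS; move Z: (alpha Y) => b.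
move=> /leq_ltn_trans/(_ aX); rewrite -{b}Z => aY as_.
(* This is [k.+2 < s] in [vanishing_edge] with [k = (3 * a).+1]; hence the factor 3 per halving. *)
have {as_ aX X} ks : (3 * a).+3 < s by lia.
move En: #|Y| => n; elim: n Y En aY => [|n IH] Y En aY.
  move/eqP: En; rewrite cards_eq0 => /eqP ->.
  by apply: vanishing_above0 => //; lia.
have IHd x : x \in Y -> vanishing (Y :\ x) s.
  move=> xY; apply: IH; first by have := cardsD1 x Y; rewrite xY En => -[].
  by apply: leq_ltn_trans aY; apply: alphaS; apply: subsetDl.
have [/existsP[x /existsP[y /and3P[xY yY xy]]]|hind] :=
  boolP [exists x, exists y, [&& x \in Y, y \in Y & adj E x y]].
  have yx : adj E y x by rewrite adjC.
  have : alpha (Y :&: nbh x :\: (y |: nbh y)) + alpha (Y :&: nbh y :\: (x |: nbh x)) <= alpha Y.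
    apply: alpha_anticomplete.
    - by apply/subsetP => u; rewrite !inE => /and3P[].
    - by apply/subsetP => u; rewrite !inE => /and3P[].
    - rewrite -setI_eq0; apply/eqP/setP => u; rewrite !inE.
      by case: (adj E x u); rewrite /= ?orbT ?andbF.
    (* An edge [uv] would make [x u v y] an induced cycle. *)
    - move=> u v; rewrite !inE !negb_or => /andP[/andP[uy nyu] /andP[_ xu]].
      move=> /andP[/andP[vx nxv] /andP[_ yv]]; apply: contraL nxv => uv.
      have := @C4_chord x u v y xu uv; rewrite (adjC u y) (negbTE nyu) orbF negbK; apply => //.
      + by rewrite adjC.
      + by rewrite eq_sym.
  rewrite expnS in aY => hsum.
  have [h|h] : alpha (Y :&: nbh x :\: (y |: nbh y)) < 2 ^ a \/
               alpha (Y :&: nbh y :\: (x |: nbh x)) < 2 ^ a by lia.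
    by apply: (vanishing_edge xY yY xy (IHa _ h)) => //; apply: IHd.
  by apply: (vanishing_edge yY xY yx (IHa _ h)) => //; apply: IHd.
have /set0Pn[x xY] : Y != set0 by rewrite -cards_eq0 En.
apply: (@vanishing_delete 1 _ x) => //; [by lia|exact: IHd|].
rewrite (_ : Y :&: nbh x = set0); first exact: vanishing_above0.
apply/setP => y; rewrite !inE; apply/negbTE; apply: contra hind => /andP[yY xy].
by apply/existsP; exists x; apply/existsP; exists y; rewrite xY yY.
Qed.

(** Double counting of the pairs [(i, u)] with [u] in [F i]. *)
Lemma sum_card_leq (J X : {set 'I_m}) (F : 'I_m -> {set 'I_m}) b :
  {in J, forall i, F i \subset X} ->
  {in X, forall u, #|[set i in J | u \in F i]| <= b} ->
  \sum_(i in J) #|F i| <= #|X| * b.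
Proof.
move=> FX hb.
have -> : \sum_(i in J) #|F i| = \sum_(i in J) \sum_(u in X) (u \in F i).
  apply: eq_bigr => i iJ; rewrite -sum1_card big_mkcond [RHS]big_mkcond; apply: eq_bigr => u _.
  by case uF: (u \in F i); [rewrite (subsetP (FX i iJ)) | case: ifP].
rewrite exchange_big /= -sum_nat_const; apply: leq_sum => u uX.
apply: leq_trans (hb u uX); rewrite -sum1_card big_mkcond [leqRHS]big_mkcond.
by apply: leq_sum => i _; rewrite inE; case: (i \in J) (u \in F i) => [] [].
Qed.

(* The private neighbourhoods [N(i) - N[x]], for [i] in [nbh x :&: I], are disjoint:
   a vertex [u] common to those of [i] and [j] gives the induced cycle [x i u j]. *)
Lemma independent_nbh_bound X I x r t : independent I -> I \subset X -> x \in X ->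
  #|X| < r * t ->
  {in X &, forall u v, adj E u v -> r <= #|X :&: nbh u :\: (v |: nbh v)|} ->
  #|nbh x :&: I| < t.
Proof.
move=> hI IX xX cX hedge.
suff h : #|nbh x :&: I| * r <= #|X|.
  rewrite -(ltn_pmul2l (_ : 0 < r)); last by case: r cX {hedge h}.
  by rewrite mulnC; apply: leq_ltn_trans cX.
have h1 : \sum_(i in nbh x :&: I) r <=
          \sum_(i in nbh x :&: I) #|X :&: nbh i :\: (x |: nbh x)|.
  apply: leq_sum => i; rewrite !inE => /andP[xi iI].
  by apply: hedge => //; [apply: (subsetP IX)|rewrite adjC].
rewrite sum_nat_const in h1; apply: leq_trans h1 _; rewrite -[leqRHS]muln1.
apply: sum_card_leq => [i _|u uX].
  by apply/subsetP => u; rewrite !inE => /and3P[].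
apply/card_le1_eqP => i j; rewrite !inE !negb_or uX /=.
move=> /andP[/andP[xi iI] /andP[/andP[ux nxu] iu]] /andP[/andP[xj jI] /andP[_ ju]].
apply/eqP; apply: contraT => ij.
have nij := independentP _ hI _ _ iI jI.
have := @C4_chord x i u j xi iu; rewrite (negbTE nij) (negbTE nxu); apply => //.
- by rewrite adjC.
- by rewrite adjC.
- by rewrite eq_sym.
- by rewrite eq_sym.
Qed.

(** Count edges between a maximum independent set [I] and [X]: at least [r] at each vertex of [I],
    fewer than [t] at each vertex of [X]. *)
Lemma alpha_bound X r t : #|X| < r * t ->
  {in X, forall x, r <= #|X :&: nbh x|} ->
  {in X &, forall u v, adj E u v -> r <= #|X :&: nbh u :\: (v |: nbh v)|} ->
  alpha X < t * t.
Proof.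
move=> cX hdeg hedge; have [I [hI IX <-]] := alpha_witness X.
have [r0 t0] : 0 < r /\ 0 < t by nia.
have h1 : \sum_(i in I) r <= \sum_(i in I) #|X :&: nbh i|.
  by apply: leq_sum => i iI; apply: hdeg; apply: (subsetP IX).
have h2 : \sum_(i in I) #|X :&: nbh i| <= #|X| * t.
  apply: sum_card_leq => [i _|u uX]; first exact: subsetIl.
  apply: leq_trans (ltnW (independent_nbh_bound hI IX uX cX hedge)).
  by apply: subset_leq_card; apply/subsetP => i; rewrite !inE uX adjC andbC.
rewrite sum_nat_const in h1; have := leq_trans h1 h2; nia.
Qed.

(** Each of the [j] levels divides the size by [2 ^ e] and costs at most 3 degrees. When no deletion
    is possible, [alpha] is below [2 ^ (e + e)] and [vanishing_alpha] accounts for [6 * e]. *)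
Lemma vanishing_card e j X : #|X| < 2 ^ (e * j) -> vanishing_above (3 * j + 6 * e).+1 X.
Proof.
elim: j X => [|j IHj] X cX.
  have /eqP-> : X == set0 by move: cX; rewrite muln0 expn0 ltnS leqn0 cards_eq0.
  by apply: vanishing_aboveS vanishing_above0.
move=> Y s /subset_leq_card; move Z: #|Y| => b.
move=> /leq_ltn_trans/(_ cX); rewrite -{b}Z => cY hs.
have {hs cX X} ks : (3 * j + 6 * e).+3 < s by lia.
have IHs W : #|W| < 2 ^ (e * j) -> vanishing_above (3 * j + 6 * e).+1 W by exact: IHj.
move En: #|Y| cY => n; elim: n Y En => [|n IH] Y En cY.
  move/eqP: En; rewrite cards_eq0 => /eqP ->.
  by apply: vanishing_above0 => //; lia.
have IHd x : x \in Y -> vanishing (Y :\ x) s.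
  move=> xY; apply: IH; last by lia.
  by have := cardsD1 x Y; rewrite xY En => -[].
have [/existsP[x /andP[xY hx]]|hdeg] :=
  boolP [exists x, (x \in Y) && (#|Y :&: nbh x| < 2 ^ (e * j))].
  by apply: (vanishing_delete xY _ (IHd x xY) (IHs _ hx)); lia.
have [/existsP[x /existsP[y /and4P[xY yY xy hxy]]]|hedge] :=
  boolP [exists x, exists y, [&& x \in Y, y \in Y, adj E x y &
     #|Y :&: nbh x :\: (y |: nbh y)| < 2 ^ (e * j)]].
  by apply: (vanishing_edge xY yY xy (IHs _ hxy) _ (IHd x xY)); lia.
have : alpha Y < 2 ^ e * 2 ^ e.
  apply: (@alpha_bound _ (2 ^ (e * j))).
  - by rewrite En -expnD -mulnSr.
  - move=> x xY; rewrite leqNgt; apply: contra hdeg => hx.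
    by apply/existsP; exists x; rewrite xY.
  - move=> x y xY yY xy; rewrite leqNgt; apply: contra hedge => hx.
    by apply/existsP; exists x; apply/existsP; exists y; rewrite xY yY xy.
rewrite -expnD => /vanishing_alpha; apply => //; lia.
Qed.
End C4free.

Local Open Scope ring_scope.

(** * Chain spaces as subspaces, and their dimension *)

Section ChainSpace.
Variables (K : fieldType) (m : nat) (E : {set 'I_m * 'I_m}).
Implicit Types (f : chains K m) (A : {set 'I_m}).

Lemma chain_of_memv A s : clique E A -> #|A| = s -> chain_of K A \in chain_space K E s.
Proof.
by move=> cA sA; apply/memv_span/mapP; exists A; rewrite // mem_enum inE cA sA eqxx.
Qed.

Lemma chain_spaceP f s : reflect (chain_on E setT s f) (f \in chain_space K E s).
Proof.
apply: (iffP idP) => [|hf].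
  rewrite /chain_space; set l := map _ _.
  rewrite -[l]/(tval (in_tuple l)) => /coord_span ->.
  elim/big_ind: _ => [A|f1 f2|i _]; [by rewrite ffunE eqxx|exact: chain_onD|].
  have : l`_i \in l by rewrite mem_nth // (ltn_ord i).
  case/mapP => B; rewrite mem_enum inE => /andP[cB /eqP sB] /= -> A.
  rewrite !ffunE; have [->|_] := eqVneq A B; last by rewrite scaler0 eqxx.
  by move=> _; split; rewrite ?subsetT.
have -> : f = \sum_A f A *: chain_of K A.
  apply/ffunP => A; rewrite sum_ffunE (bigD1 A) //= !ffunE eqxx big1 ?addr0.
    by rewrite /GRing.scale /= mulr1.
  by move=> B; rewrite !ffunE eq_sym => /negbTE->; rewrite scaler0.
apply: memv_suml => A _; have [->|/hf[cA sA _]] := eqVneq (f A) 0.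
  by rewrite scale0r mem0v.
by apply/memvZ/chain_of_memv.
Qed.

Lemma dim_chain_space_le s : (\dim (chain_space K E s) <= m ^ s)%N.
Proof.
apply: leq_trans (dim_span _) _; rewrite size_map -cardE.
have bin_le n k : ('C(n, k) <= n ^ k)%N.
  elim: n k => [|n IH] [|k] //; rewrite ?bin0 // binS expnS.
  have := IH k.+1; have := IH k; have : (n ^ k <= n.+1 ^ k)%N by case: (k) => // k'; rewrite leq_exp2r.
  rewrite expnS; nia.
apply: leq_trans (bin_le m s); rewrite -[X in 'C(X, _)]card_ord -card_draws.
by apply: subset_leq_card; apply/subsetP => A; rewrite !inE => /andP[].
Qed.
End ChainSpace.

(** * Upper bound by counting small cliques *)

Section UpperBound.
Variables (K : fieldType) (m : nat) (E : {set 'I_m * 'I_m}).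

Lemma vanishing_reduced_betti s : vanishing K E setT s -> reduced_betti K E s = 0%N.
Proof.
move=> hv; apply/eqP; rewrite subn_eq0; apply: dimvS; apply/subvP => z.
rewrite memv_cap memv_ker boundaryE => /andP[/eqP zcyc /chain_spaceP zC].
have [u /chain_spaceP uC <-] := hv z zC zcyc.
by rewrite -boundaryE memv_img.
Qed.

Lemma reduced_betti_le s : (reduced_betti K E s <= m ^ s)%N.
Proof.
apply: leq_trans (dim_chain_space_le K E s); apply: leq_trans (leq_subr _ _) _.
by apply: dimvS; apply: capvSr.
Qed.

Lemma total_betti_le n e : simple_graph E -> ~~ has_induced_C4 E ->
  (m <= n)%N -> (1 < n)%N -> (n < 2 ^ (e * e))%N -> (total_betti K E <= n ^ (9 * e).+1)%N.
Proof.
(* The threshold [3 * j + 6 * e + 1] at [j = e]. *)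
move=> sE cE mn n1 ne; set k := (9 * e).+1; rewrite /total_betti.
have term s : (reduced_betti K E s <= if s < k then n ^ s else 0)%N.
  case: ltnP => [_|ks].
    by apply: leq_trans (reduced_betti_le s) _; case: s => // s; rewrite leq_exp2r.
  rewrite vanishing_reduced_betti //.
  have cT : (#|[set: 'I_m]| < 2 ^ (e * e))%N by rewrite cardsT card_ord; lia.
  by apply: (vanishing_card sE cE cT) => //; lia.
(* The geometric sum is absorbed because [n ^ M + n ^ M <= n ^ M.+1] for [n >= 2]. *)
have sum M : (\sum_(s < M) reduced_betti K E s <= n ^ minn M k)%N.
  elim: M => [|M IH]; first by rewrite big_ord0.
  rewrite big_ord_recr /=; apply: leq_trans (leq_add IH (term M)) _.
  case: ltnP => Mk.
    rewrite (minn_idPl Mk) expnS; nia.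
  by rewrite addn0 (minn_idPr (leqW Mk)).
by apply: leq_trans (sum m.+1) _; rewrite leq_exp2l ?geq_minr.
Qed.
End UpperBound.

Lemma b_C4_le (K : fieldType) n e : (1 < n)%N -> (n < 2 ^ (e * e))%N ->
  (b_C4 K n <= n ^ (9 * e).+1)%N.
Proof.
move=> n1 ne; apply/bigmax_leqP => -[m mn] _ /=; apply/bigmax_leqP => E /andP[sE cE].
exact: total_betti_le.
Qed.

(** * First Betti number of triangle-free graphs *)

Section LowerBound.
Variables (K : fieldType) (m : nat) (E : {set 'I_m * 'I_m}).

Lemma chain_of_free (l : seq {set 'I_m}) : uniq l -> free [seq chain_of K A | A <- l].
Proof.
elim: l => [|B l IH] /=; first by rewrite nil_free.
case/andP=> Bl ul; rewrite free_cons IH // andbT; apply/negP.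
set X := map _ _; rewrite -[X]/(tval (in_tuple X)) => /coord_span.
move/(congr1 (fun f : chains K m => f B)); rewrite ffunE eqxx sum_ffunE big1.
  by move/eqP; rewrite oner_eq0.
move=> i _; have : X`_i \in X by rewrite mem_nth // (ltn_ord i).
case/mapP => A Al /= ->; rewrite !ffunE; have [BA|_] := eqVneq B A.
  by rewrite BA Al in Bl.
by rewrite scaler0.
Qed.

Lemma dim_chain_space s :
  \dim (chain_space K E s) = #|[set A : {set 'I_m} | clique E A && (#|A| == s)]|.
Proof.
by rewrite (eqP (chain_of_free _)) ?enum_uniq // size_map -cardE.
Qed.

Lemma chain_on_boundary s (z : chains K m) :
  chain_on E setT s.+1 z -> chain_on E setT s (boundary_fun z).
Proof.
move=> hz A; rewrite boundary_funE => nz.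
have [v /andP[vA zv]] : exists v, (v \notin A) && (z (v |: A) != 0).
  apply/existsP; apply: contraNT nz => /existsPn h; apply/eqP/big1 => v vA.
  by have := h v; rewrite vA /= negbK => /eqP->; rewrite mulr0.
have [cA sA _] := hz _ zv; split; rewrite ?subsetT //.
  by apply: cliqueS cA; apply: subsetUr.
by move: sA; rewrite cardsU1 vA => -[].
Qed.

(** Without triangles the first homology is the whole cycle space of the edges; by rank-nullity its
    dimension is the number of edges minus a rank of at most [m]. *)
Lemma triangle_free_total_betti : (1 < m)%N ->
  (forall A : {set 'I_m}, clique E A -> #|A| <= 2)%N ->
  (#|[set A : {set 'I_m} | clique E A && (#|A| == 2)]| <= total_betti K E + m)%N.
Proof.
move=> m1 hA; have m2 : (2 < m.+1)%N by [].
have C3 : chain_space K E 3 = 0%VS.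
  apply/eqP; rewrite -dimv_eq0 dim_chain_space cards_eq0; apply/eqP/setP => A.
  by rewrite !inE; apply/negP => /andP[/hA sA /eqP A3]; rewrite A3 in sA.
have : (reduced_betti K E 2 <= total_betti K E)%N.
  by rewrite /total_betti (bigD1 (Ordinal m2)) //= leq_addr.
rewrite /reduced_betti C3 limg0 dimv0 subn0 -dim_chain_space capvC.
rewrite -(limg_ker_dim (boundary K m) (chain_space K E 2)) => h.
rewrite leq_add //.
have := dim_chain_space_le K E 1; rewrite expn1; apply: leq_trans.
apply: dimvS; apply/subvP => _ /memv_imgP[z /chain_spaceP zC ->].
by rewrite boundaryE; apply/chain_spaceP/chain_on_boundary.
Qed.
End LowerBound.

(** * Point-line incidence graph of an affine plane *)

Section IncidenceGraph.
Variable F : finFieldType.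

(* [inl (a, b)] is the point [(a, b)] and [inr (c, d)] the line [y = c x + d]. *)
Local Notation V := ((F * F) + (F * F))%type.

Definition on_line (p l : F * F) : bool := p.2 == l.1 * p.1 + l.2.

Definition incident (x y : V) : bool :=
  match x, y with
  | inl p, inr l => on_line p l
  | inr l, inl p => on_line p l
  | _, _ => false
  end.

Definition incidence_graph : {set 'I_#|{: V}| * 'I_#|{: V}|} :=
  [set e | incident (enum_val e.1) (enum_val e.2)].

Local Notation G := incidence_graph.

Lemma adj_incidence x y : adj G x y = incident (enum_val x) (enum_val y).
Proof. by rewrite /adj inE. Qed.

(** Subtracting the four line equations leaves [(c - c') * (a - a') = 0]. *)
Lemma on_line_unique p p' l l' : on_line p l -> on_line p l' -> on_line p' l ->
  on_line p' l' -> p = p' \/ l = l'.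
Proof.
case: p p' l l' => [a b] [a' b'] [c d] [c' d']; rewrite /on_line /=.
move=> /eqP-> /eqP h1 /eqP-> /eqP h2.
have : (c - c') * (a - a') = 0.
  have -> : (c - c') * (a - a') = (c * a + d) - (c * a' + d) - (c' * a + d') + (c' * a' + d').
    rewrite mulrBl !mulrBr; ring.
  rewrite h1 h2; ring.
move/eqP; rewrite mulf_eq0 !subr_eq0 => /orP[/eqP ec|/eqP ->]; last by left.
by right; move: h1; rewrite ec => /addrI->.
Qed.

Lemma incidence_simple : simple_graph G.
Proof.
apply/andP; split; apply/forallP => x; first by rewrite adj_incidence; case: (enum_val x).
by apply/forallP => y; rewrite !adj_incidence; case: (enum_val x); case: (enum_val y).
Qed.

Lemma incidence_C4_free : ~~ has_induced_C4 G.
Proof.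
apply/negP => /existsP[f /andP[/injectiveP finj /forallP hf]].
have e i j : C4_adj i j -> incident (enum_val (f i)) (enum_val (f j)).
  by move=> ij; move/forallP: (hf i) => /(_ j) /eqP; rewrite adj_incidence ij.
have ne i j : i != j -> enum_val (f i) <> enum_val (f j) :> V.
  by move/eqP => ij /enum_val_inj /finj.
pose i0 : 'I_4 := inord 0; pose i1 : 'I_4 := inord 1.
pose i2 : 'I_4 := inord 2; pose i3 : 'I_4 := inord 3.
have ord_ne (i j : nat) : (i < 4)%N -> (j < 4)%N -> i != j -> inord i != inord j :> 'I_4.
  by move=> hi hj; apply: contraNneq => /(congr1 val); rewrite /= !inordK // => ->.
have := (ne i0 i2 (ord_ne 0%N 2%N isT isT isT), ne i1 i3 (ord_ne 1%N 3%N isT isT isT)).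
have C i j : (i < 4)%N -> (j < 4)%N -> (j == i.+1 %% 4)%N -> C4_adj (inord i) (inord j).
  by move=> hi hj /eqP hij; rewrite /C4_adj !inordK // hij eqxx.
have := (e i0 i1 (C 0%N 1%N isT isT isT), e i1 i2 (C 1%N 2%N isT isT isT),
         e i2 i3 (C 2%N 3%N isT isT isT), e i3 i0 (C 3%N 0%N isT isT isT)).
(* Points and lines alternate around the cycle, which leaves two patterns, each with two points on
   two common lines. *)
case: (enum_val (f i0)) (enum_val (f i1)) (enum_val (f i2)) (enum_val (f i3))
  => [p|l] [p'|l'] [q|k] [q'|k'] /= [[[h1 h2] h3] h4] [n02 n13] //.
- by case: (on_line_unique h1 h4 h2 h3) => eq; [apply: n02|apply: n13]; rewrite eq.
- by case: (on_line_unique h1 h2 h4 h3) => eq; [apply: n13|apply: n02]; rewrite eq.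
Qed.

Lemma incidence_clique_card A : clique G A -> (#|A| <= 2)%N.
Proof.
move=> /cliqueP cA; pose side (x : 'I_#|{: V}|) := if (enum_val x : V) is inl _ then true else false.
rewrite -card_bool -(card_in_imset (f := side) (D := mem A)) ?max_card // => x y xA yA.
rewrite /side => sxy; apply/eqP; apply: contraT => xy; have := cA x y xA yA xy.
by rewrite adj_incidence; case: (enum_val x) (enum_val y) sxy => [?|?] [].
Qed.

Lemma incidence_edges :
  (#|F| ^ 3 <= #|[set A : {set 'I_#|{: V}|} | clique G A && (#|A| == 2)]|)%N.
Proof.
(* An edge is a triple [t = (a, c, d)]: the line [y = c x + d] and its point with abscissa [a]. *)
pose pt (t : F * F * F) := enum_rank (inl (t.1.1, t.1.2 * t.1.1 + t.2) : V).
pose ln (t : F * F * F) := enum_rank (inr (t.1.2, t.2) : V).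
pose g t := [set pt t; ln t].
have ne t t' : pt t != ln t' by apply/eqP => /enum_rank_inj.
have ginj : injective g.
  move=> t t' gE; have : pt t \in g t' by rewrite -gE set21.
  rewrite !inE (negbTE (ne _ _)) orbF => /eqP /enum_rank_inj [ea _].
  have : ln t \in g t' by rewrite -gE set22.
  rewrite !inE eq_sym (negbTE (ne _ _)) /= => /eqP /enum_rank_inj [ec ed].
  by case: t t' ea ec ed {gE} => [[a c] d] [[a' c'] d'] /= -> -> ->.
have -> : (#|F| ^ 3 = #|g @: setT|)%N.
  by rewrite card_imset // cardsT !card_prod expnSr expnSr expn1.
apply: subset_leq_card; apply/subsetP => _ /imsetP[t _ ->].
rewrite inE cards2 ne eqxx andbT; apply/cliqueP => x y; rewrite !inE.
by case/orP => /eqP-> /orP[] /eqP->; rewrite ?eqxx // adj_incidence !enum_rankK //= /on_line eqxx.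
Qed.

Lemma incidence_total_betti (K : fieldType) :
  (#|F| ^ 3 <= total_betti K G + 2 * #|F| ^ 2)%N.
Proof.
have cV : #|{: V}| = (2 * #|F| ^ 2)%N by rewrite card_sum card_prod mul2n -addnn.
rewrite -[in leqRHS]cV; apply: leq_trans incidence_edges _.
apply: triangle_free_total_betti; last exact: incidence_clique_card.
by rewrite cV; have : (0 < #|F|)%N by [apply/card_gt0P; exists 0]; nia.
Qed.
End IncidenceGraph.

(** * Bounds on [b_C4] in natural numbers *)

Lemma b_C4_ge (K : fieldType) k n : (0 < k)%N -> (2 * (2 ^ k) ^ 2 <= n)%N ->
  ((2 ^ k) ^ 3 <= b_C4 K n + 2 * (2 ^ k) ^ 2)%N.
Proof.
move=> k0 hn; have [F _ cF] := PrimePowerField (isT : prime 2) k0.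
have cV : #|{: (F * F) + (F * F)}| = (2 * #|F| ^ 2)%N by rewrite card_sum card_prod mul2n -addnn.
have hm : (#|{: (F * F) + (F * F)}| < n.+1)%N by rewrite cV cF ltnS.
rewrite -cF; apply: leq_trans (incidence_total_betti F K) _; rewrite leq_add2r.
apply: leq_trans (leq_bigmax (Ordinal hm)) => /=.
by apply: (leq_bigmax_cond (incidence_graph F)); rewrite incidence_simple incidence_C4_free.
Qed.

Lemma b_C4_lower (K : fieldType) n : (32 <= n)%N ->
  exists q, [/\ (4 <= q)%N, (n < 8 * (q * q))%N & (q * q * q <= 2 * b_C4 K n)%N].
Proof.
move=> n32; have n2 : (0 < n %/ 2)%N by lia.
have /andP[lo hi] := trunc_log_bounds (isT : (1 < 4)%N) n2.
(* The largest [k] with [2 * 4 ^ k <= n], so [q = 2 ^ k] satisfies [2 * q ^ 2 <= n < 8 * q ^ 2]. *)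
set k := trunc_log 4 (n %/ 2) in lo hi; exists (2 ^ k)%N.
have E4 : (4 ^ k = 2 ^ k * 2 ^ k)%N by rewrite -expnMn.
have k2 : (2 <= k)%N.
  by rewrite -ltnS -(ltn_exp2l _ _ (isT : (1 < 4)%N)); apply: leq_ltn_trans hi; lia.
(* From [q >= 4] one gets [q ^ 3 - 2 * q ^ 2 >= q ^ 3 / 2]. *)
have q4 : (4 <= 2 ^ k)%N by rewrite -[4%N]/(2 ^ 2)%N leq_exp2l.
rewrite expnS E4 in hi; rewrite E4 in lo.
split=> //; first by lia.
have := @b_C4_ge K k n; rewrite !expnS expn0 !muln1 mulnA; move: (2 ^ k)%N q4 lo {hi E4} => q q4 lo.
by move=> /(_ (ltnW k2)) H; have {}H := H ltac:(lia); nia.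
Qed.

Lemma b_C4_upper (K : fieldType) n : (1 < n)%N ->
  exists e, (2 ^ (e * e) <= n)%N /\ (b_C4 K n <= n ^ (9 * e + 10))%N.
Proof.
move=> n1; have ex : exists e, (n < 2 ^ (e * e))%N.
  exists n; apply: leq_trans (ltn_expl n (isT : (1 < 2)%N)) _.
  by rewrite leq_exp2l // leq_pmulr // ltnW.
(* Minimality of [e.+1] bounds [e] by the square root of the binary logarithm of [n]; the exponent
   is [9 * e.+1 + 1]. *)
case: (ex_minnP ex) => -[|e] ne emin; first by rewrite expn0 in ne; lia.
exists e; split; first by rewrite leqNgt; apply/negP => /emin; rewrite ltnn.
by have := b_C4_le K n1 ne; rewrite mulnS -addSn addnC.
Qed.

(* Translation to real exponents *)
From Stdlib Require Import Reals Lra Psatz.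
Open Scope R_scope.

Lemma INR_expn n k : INR (expn n k) = INR n ^ k.
Proof. by elim: k => [|k IH] //; rewrite expnS mult_INR IH. Qed.

(** Rounding [8 * q ^ 2] up to the square of [3 * q] gives the constant [27 = 3 ^ 3]. *)
Lemma Rpower_three_halves_lt (n q : nat) : (0 < n)%nat -> (n < 8 * (q * q))%nat ->
  Rpower (INR n) (3 / 2) < 27 * (INR q * INR q * INR q).
Proof.
move=> n0 nq.
have q0 : 0 < INR q by apply: lt_0_INR; nia.
have nR : 0 < INR n by apply: lt_0_INR; lia.
have nqR : INR n < Rpower (3 * INR q) (INR 2).
  rewrite Rpower_pow; last by lra.
  have : INR n < INR (8 * (q * q)) by apply: lt_INR; lia.
  by rewrite !mult_INR /=; nra.
have h : Rpower (INR n) (3 / 2) < Rpower (Rpower (3 * INR q) (INR 2)) (3 / 2).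
  by apply: Rlt_Rpower_l; lra.
apply: (Rlt_le_trans _ _ _ h); rewrite Rpower_mult.
have -> : INR 2 * (3 / 2) = INR 3 by rewrite /=; lra.
by rewrite Rpower_pow /=; lra.
Qed.

Lemma ln_nondecreasing x y : 0 < x -> x <= y -> ln x <= ln y.
Proof.
move=> x0 /Rle_lt_or_eq_dec[xy|->]; last exact: Rle_refl.
exact/Rlt_le/ln_increasing.
Qed.

Lemma INR_expn_lt_Rpower (n e : nat) : (3 <= n)%nat -> (expn 2 (e * e) <= n)%nat ->
  INR (expn n (9 * e + 10)) < Rpower (INR n) (30 * sqrt (ln (INR n))).
Proof.
move=> n3 he.
have n3R : 3 <= INR n by have : INR 3 <= INR n by [apply: le_INR; lia]; rewrite /=; lra.
have ln1 : 1 <= ln (INR n).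
  rewrite -(ln_exp 1); apply: ln_nondecreasing; [exact: exp_pos | have := exp_le_3; lra].
have heR : 2 ^ (e * e) <= INR n.
  have : INR (expn 2 (e * e)) <= INR n by apply: le_INR; lia.
  by rewrite INR_expn.
have he2 : INR e * INR e * ln 2 <= ln (INR n).
  rewrite -mult_INR -ln_pow; last by lra.
  by apply: ln_nondecreasing heR; apply: pow_lt; lra.
have hln2 := ln_lt_2.
have S2 := sqrt_sqrt (ln (INR n)) ltac:(lra).
have S1 : 1 <= sqrt (ln (INR n)) by rewrite -sqrt_1; apply: sqrt_le_1; lra.
have e0 := pos_INR e.
(* Uses [ln 2 > 1 / 2] and [sqrt 2 < 3 / 2]. *)
have eS : INR e <= 3 / 2 * sqrt (ln (INR n)) by nra.
rewrite INR_expn -Rpower_pow; last by lra.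
apply: Rpower_lt; first by lra.
(* With [S = sqrt (ln n) >= 1], the exponent is at most [27 / 2 * S + 10 * S < 30 * S]. *)
by rewrite plus_INR mult_INR /=; lra.
Qed.

Theorem theorem1p4 (K : fieldType) :
  exists c C : R, 0 < c /\ 0 < C /\
    exists N : nat, forall n : nat, (N <= n)%nat ->
      c * Rpower (INR n) (3 / 2) < INR (b_C4 K n) /\
      INR (b_C4 K n) < Rpower (INR n) (C * sqrt (ln (INR n))).
Proof.
(* [54 = 27 * 2], from [n ^ (3 / 2) < 27 * q ^ 3] and [q ^ 3 <= 2 * b_C4 K n]. *)
exists (1 / 54), 30; do 2 (split; first lra).
exists 32%nat => n n32; split.
  have [q [q4 nq hq]] := b_C4_lower K n32.
  have h := @Rpower_three_halves_lt n q ltac:(lia) nq.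
  have : INR (q * q * q) <= INR (2 * b_C4 K n) by apply: le_INR; lia.
  by rewrite !mult_INR /=; lra.
have [e [he hb]] := @b_C4_upper K n ltac:(lia).
apply: Rle_lt_trans (@INR_expn_lt_Rpower n e ltac:(lia) he).
by apply: le_INR; apply/leP.
Qed.
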